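(* Let $G$ be a Garside group and $x\in G$. The following algorithm, applied to $x$, terminates and returns an element of $C^*(x)$: (a) Set $q=\inf x+1$. (b) While $q<\sup x$ (with $x$ denoting the current value), compute $x,\mathrm{c}_q(x),\mathrm{c}_q^2(x),\dots,\mathrm{c}_q^N(x)$ until a repetition is encountered (i.e. $\mathrm{c}_q^N(x)$ equals one of the earlier terms of the list); replace $x$ by $\mathrm{c}_q^N(x)$ and replace $q$ by $q+1$. (c) Return $x$.
   Context: Garside groups. A monoid $M$ is atomic if it is generated by its atoms (elements $x\ne1$ such that $x=yz$ implies $y=1$ or $z=1$) and every $x\in M$ has a finite norm $\|x\|$, the maximal number of factors in an expression of $x$ as a product of atoms. A Garside monoid is a cancellative atomic monoid $M$ in which any two elements have left and right greatest common divisors and left and right least common multiples, together with a Garside element $\Delta\in M$: its left divisors coincide with its right divisors, and they form a finite set $S$ (the simple elements) generating $M$. A Garside group $G$ is the group of fractions of a Garside monoid $M$. For $x,y\in G$, $x\prec y$ means $x^{-1}y\in M$ (a partial order on $G$), and $x\wedge y$, $x\vee y$ are the greatest lower bound and least upper bound with respect to $\prec$. Write $x^u=u^{-1}xu$. Every $x\in G$ has a unique normal form $x=\Delta^p x_1\cdots x_l$ with $x_i\in S\setminus\{1,\Delta\}$ and $x\wedge\Delta^{p+i}=\Delta^p x_1\cdots x_i$ for $0\le i\le l$; put $\inf x=p$, $\sup x=p+l$. For $q\in\mathbb{Z}$ the cycling operation of order $q$ is $\mathrm{c}_q(x)=x^{x\wedge\Delta^q}$, and $G_q=\{x\in G\mid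 \mathrm{c}_q^N(x)=x\text{ for some }N>0\}$. With $C(x)$ the conjugacy class of the input element $x$, the fully refined summit set is $C^*(x)=C(x)\cap\bigcap_{q\in\mathbb{Z}}G_q$. *)

(* Defs.v *)
From HB Require Import structures.
From mathcomp Require Import all_boot all_order all_algebra.
From mathcomp Require Import boolp classical_sets cardinality.

Set Implicit Arguments.
Unset Strict Implicit.
Unset Printing Implicit Defensive.

Import Order.TTheory GRing.Theory Num.Theory.
Local Open Scope classical_set_scope.
Local Open Scope group_scope.

Section GarsideMonoid.
Context {M : monoidType}.
Implicit Types x y z d m : M.

Definition ldiv x y : Prop := exists z, y = x * z.
Definition rdiv x y : Prop := exists z, y = z * x.

Definition atom x : Prop := x <> 1 /\ forall y z, x = y * z -> y = 1 \/ z = 1.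

Definition atomic_expr x (s : seq M) : Prop :=
  (forall a, a \in s -> atom a) /\ \prod_(a <- s) a = x.

(* ||x|| = n *)
Definition is_norm x (n : nat) : Prop :=
  (exists2 s, atomic_expr x s & size s = n) /\
  (forall s, atomic_expr x s -> (size s <= n)%N).

(* glb and lub for a divisibility preorder *)
Definition is_gcd (div : M -> M -> Prop) x y d : Prop :=
  [/\ div d x, div d y & forall z, div z x -> div z y -> div z d].
Definition is_lcm (div : M -> M -> Prop) x y m : Prop :=
  [/\ div x m, div y m & forall z, div x z -> div y z -> div m z].

(* [Delta] is part of the data of a Garside monoid. *)
Record garside_monoid (Delta : M) : Prop := GarsideMonoid {
  garside_mulgI : forall x y z, x * y = x * z -> y = z;
  garside_mulIg : forall x y z, y * x = z * x -> y = z;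
  garside_atoms_generate : forall x, exists s, atomic_expr x s;
  garside_finite_norm : forall x, exists n, is_norm x n;
  garside_lgcd : forall x y, exists d, is_gcd ldiv x y d;
  garside_rgcd : forall x y, exists d, is_gcd rdiv x y d;
  garside_llcm : forall x y, exists m, is_lcm ldiv x y m;
  garside_rlcm : forall x y, exists m, is_lcm rdiv x y m;
  garside_ldiv_rdiv : forall s, ldiv s Delta <-> rdiv s Delta;
  garside_finite_simple : finite_set [set s | ldiv s Delta];
  garside_simple_generate : forall x, exists2 s : seq M,
    (forall a, a \in s -> ldiv a Delta) & \prod_(a <- s) a = x
}.

End GarsideMonoid.

Record group_of_fractions {M : monoidType} {G : groupType} (iota : M -> G) :
    Prop := GroupOfFractions {
  fractions_morphism : monoid.monoid_morphism iota;
  fractions_injective : injective iota;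
  fractions_surjective : forall g, exists a b, g = (iota a)^-1 * iota b
}.

Definition expgz {G : groupType} (g : G) (n : int) : G :=
  match n with Posz k => g ^+ k | Negz k => g ^- k.+1 end.

Section GarsideGroup.
Context {M : monoidType} {G : groupType} (iota : M -> G) (Delta : M).
Implicit Types (x y u d : G) (p q : int) (s : seq M).

Definition prec x y : Prop := exists m : M, x^-1 * y = iota m.

Definition is_meet x y d : Prop :=
  [/\ prec d x, prec d y & forall z, prec z x -> prec z y -> prec z d].

(* The default value 1 is irrelevant: in a Garside group meets exist and are
   unique. *)
Definition meet x y : G := xget 1 [set d | is_meet x y d].

Definition DeltaX p : G := expgz (iota Delta) p.

(* The pair (p, [:: x_1; ...; x_l]) is a normal form of x. *)
Definition is_normal_form x (ps : int * seq M) : Prop :=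
  let: (p, s) := ps in
  [/\ x = DeltaX p * iota (\prod_(a <- s) a),
      forall a, a \in s -> [/\ ldiv a Delta, a <> 1 & a <> Delta]
    & forall i : nat, (i <= size s)%N ->
        meet x (DeltaX (p + i%:Z)%R)
        = DeltaX p * iota (\prod_(a <- take i s) a)].

(* The default value is irrelevant: in a Garside group normal forms exist; they
   are unique unless M is trivial. *)
Definition normal_form x : int * seq M := xget (0%R, [::]) (is_normal_form x).

Definition nf_inf x : int := (normal_form x).1.
Definition nf_sup x : int := ((normal_form x).1 + (size (normal_form x).2)%:Z)%R.

Definition cycling q x : G := x ^ meet x (DeltaX q).

Definition cycling_periodic q : set G :=
  [set x | exists2 N : nat, (0 < N)%N & iter N (cycling q) x = x].

Definition conj_class x : set G := [set y | exists u, y = x ^ u].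

Definition fully_refined_summit_set x : set G :=
  conj_class x `&` \bigcap_(q in [set: int]) cycling_periodic q.

(* N is the index of the first term of x, f x, f (f x), ... that equals an
   earlier one. *)
Definition first_repetition (f : G -> G) x (N : nat) : Prop :=
  looping f x N /\ forall n, (n < N)%N -> ~~ looping f x n.

(* Big-step semantics of the while loop: [while_returns q x y] says that,
   entered with the values q and x, the loop stops after finitely many rounds
   with final value y.  There is no derivation if the iteration of [cycling q]
   in some round never meets a repetition, or if there are infinitely many
   rounds. *)
Inductive while_returns : int -> G -> G -> Prop :=
| WhileExit q x : ~~ (q < nf_sup x)%R -> while_returns q x x
| WhileRound q x N y :
    (q < nf_sup x)%R -> first_repetition (cycling q) x N ->
    while_returns (q + 1)%R (iter N (cycling q) x) y ->
    while_returns q x y.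

Definition algorithm_returns x y : Prop := while_returns (nf_inf x + 1)%R x y.

End GarsideGroup.

(* Main.v *)
(** The transport [s |-> (x /\ D^p)^-1 s (x^s /\ D^p)] carries conjugators of [x]
    to conjugators of [c_p x].  It equals [(x /\ D^p)^-1 (x s /\ s D^p)], so it
    preserves meets, and it fixes the powers of [D = Delta], so it acts on the
    finite intervals [[D^a, D^b]].  If [x] and [x^s] are both fixed by [c_p^N], the
    [N]-fold transport is [s |-> u^-1 s v] on the conjugators from [x] to [x^s],
    hence injective there, and [s] is periodic under it.  Consequently
    [x, x^s, x^t] in [G_p] imply [x^(s /\ t)] in [G_p]; taking [s = x] and
    [t = D^q] shows that every cycling [c_q] preserves every [G_p].  So the rounds
    of the algorithm accumulate the conditions [G_p], those with [p <= inf x] or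
    [p >= sup x] being automatic.  The same argument shows that cyclings preserve
    the sets [[D^a, D^b]], which gives termination. *)

Require Import Defs.
From mathcomp Require Import all_boot all_order all_algebra.
From mathcomp Require Import boolp classical_sets cardinality.
From mathcomp Require Import zify.

Set Implicit Arguments.
Unset Strict Implicit.
Unset Printing Implicit Defensive.

Import Order.TTheory GRing.Theory Num.Theory.
Local Open Scope classical_set_scope.
Local Open Scope group_scope.

(** * Iteration of self-maps on finite sets *)

Lemma finite_bounded (T : Type) (A : set T) (f : T -> int) :
  finite_set A -> exists B : int, forall x, A x -> (f x <= B)%R.
Proof.
move=> /(finite_image f) /finite_seqP [s fAs].
(* A crude bound: each value is at most its absolute value, which is one term of a sum of
   nonnegative terms. *)
exists (\sum_(k <- s) `|k|)%R => x Ax.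
have : f x \in s by rewrite -/([set` s] (f x)) -fAs; exists x.
move=> /(nthP 0%R) [i ltis <-].
apply: (le_trans (ler_norm _)); rewrite (big_nth 0%R) big_mkord.
rewrite (bigD1 (Ordinal ltis)) //= lerDl; exact: sumr_ge0.
Qed.

(** Pigeonhole: without a repetition, [size s + 1] distinct terms of the orbit would lie in [s]. *)
Lemma finite_orbit_looping (T : eqType) (A : set T) (f : T -> T) (x : T) :
  finite_set A -> (forall n, A (iter n f x)) -> exists n, looping f x n.
Proof.
move=> /finite_seqP [s As] Ax; exists (size s); apply/negPn/negP.
rewrite -looping_uniq => /uniq_leq_size le.
suff /le : {subset traject f x (size s).+1 <= s} by rewrite size_traject ltnn.
by move=> _ /trajectP [i _ ->]; rewrite -/([set` s] _) -As.
Qed.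

(** The orbit repeats by finiteness, and injectivity on [A] cancels [f] on both sides of the
    repetition until the earlier index is 0. *)
Lemma finite_injective_periodic (T : eqType) (A : set T) (f : T -> T) (x : T) :
  finite_set A -> (forall y, A y -> A (f y)) ->
  (forall y z, A y -> A z -> f y = f z -> y = z) -> A x ->
  exists2 n, (0 < n)%N & iter n f x = x.
Proof.
move=> finA Af injf Ax.
have Aiter n : A (iter n f x) by elim: n => //= n; exact: Af.
have [n /trajectP [i ltin]] := finite_orbit_looping finA Aiter.
elim: i n ltin => [|i IHi] [|n] // ltin eq_iter; first by exists n.+1.
by apply: (IHi n) => //; apply: injf.
Qed.

Lemma first_repetition_exists (G : groupType) (f : G -> G) (x : G) :
  (exists n, looping f x n) -> exists N, first_repetition f x N.
Proof.
move=> ex; exists (ex_minn ex); case: ex_minnP => N loopN minN; split=> // n.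
by rewrite ltnNge; apply: contra => /minN.
Qed.

Lemma first_repetition_periodic (G : groupType) (f : G -> G) (x : G) (N : nat) :
  first_repetition f x N ->
  exists2 n, (0 < n)%N & iter n f (iter N f x) = iter N f x.
Proof.
case=> /trajectP [i ltiN eqN] _; exists (N - i)%N; first by rewrite subn_gt0.
by rewrite {1}eqN -iterD subnK // ltnW.
Qed.

Lemma iter_periodic (T : Type) (f : T -> T) (x : T) (m n : nat) :
  iter n f x = x -> iter (m * n) f x = x.
Proof. by move=> fx; elim: m => // m IHm; rewrite mulSn iterD IHm. Qed.

(** * Integer powers in a group *)

Section ExpgZ.
Context {G : groupType}.
Implicit Types (g h : G) (m n : int).

Lemma expgzS g n : expgz g (n + 1)%R = expgz g n * g.
Proof.
case: n => [n|[|n]]; first by rewrite addrC -intS /= expgSr.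
  by rewrite /= mulVg.
rewrite NegzE (_ : (- n.+2%:Z + 1 = - n.+1%:Z)%R) -?NegzE; last lia.
by rewrite /= [g ^+ n.+2]expgS invgM mulgVK.
Qed.

Lemma expgzD g m n : expgz g (m + n)%R = expgz g m * expgz g n.
Proof.
elim: n => [|n IHn|n IHn]; first by rewrite addr0 mulg1.
  by rewrite intS (addrC 1%R) addrA !expgzS IHn mulgA.
have E: (- n%:Z = - n.+1%:Z + 1)%R by lia.
apply: (mulIg g); rewrite -mulgA -!expgzS -E -IHn; congr expgz; lia.
Qed.

Lemma expgzN g n : expgz g (- n)%R = (expgz g n)^-1.
Proof. by apply: (mulIg (expgz g n)); rewrite -expgzD addNr mulVg. Qed.

End ExpgZ.

(** * Units and the Garside element in a Garside monoid *)

Section GarsideMonoidTheory.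
Context {M : monoidType} {Delta : M} (hM : garside_monoid Delta).
Implicit Types (a b s m : M).

(** Concatenating copies of atomic expressions of [a] and [b] gives arbitrarily long expressions of
    1, against its finite norm, unless the expression of [a] is empty. *)
Lemma garside_conical a b : a * b = 1 -> a = 1.
Proof.
move=> ab1; have [n [_ maxn]] := garside_finite_norm hM 1.
have [sa [atoma pa]] := garside_atoms_generate hM a.
have [sb [atomb pb]] := garside_atoms_generate hM b.
pose t k := iter k (cat (sa ++ sb)) [::].
have atomt k : atomic_expr 1 (t k).
  elim: k => [|k [atomk pk]]; first by split=> //; rewrite big_nil.
  split=> [c|] /=; last by rewrite !big_cat /= pa pb pk mulg1.
  by rewrite !mem_cat => /orP [/orP [/atoma|/atomb]|/atomk].
have sizet k : size (t k) = (k * (size sa + size sb))%N.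
  by elim: k => //= k; rewrite !size_cat => ->; rewrite mulSn.
move: (maxn _ (atomt n.+1)); rewrite sizet.
by case: sa pa {t atomt sizet atoma} => [|? ? _] /=; [rewrite big_nil | lia].
Qed.

(** If [Delta = s * r], then [r] is a right divisor of [Delta], hence also a left one:
    [Delta = r * t], and [s * Delta = s * r * t = Delta * t]. *)
Lemma simple_twistl s : ldiv s Delta -> exists t, s * Delta = Delta * t.
Proof.
case=> r Er; have [t Et] : ldiv r Delta.
  by apply/(garside_ldiv_rdiv hM); exists s.
by exists t; rewrite {2}Er -mulgA -Et.
Qed.

Lemma simple_twistr s : ldiv s Delta -> exists t, Delta * s = t * Delta.
Proof.
move=> /(garside_ldiv_rdiv hM) [r Er].
have [t Et] : rdiv r Delta by apply/(garside_ldiv_rdiv hM); exists s.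
by exists t; rewrite {2}Er mulgA -Et.
Qed.

Lemma garside_twistl m : exists t, m * Delta = Delta * t.
Proof.
have [s + <-] := garside_simple_generate hM m.
elim: s => [_|a s IHs simple_s]; first by exists 1; rewrite big_nil mul1g mulg1.
have [b Eb] := simple_twistl (simple_s a (mem_head _ _)).
have [|t Et] := IHs => [c cs|]; first by apply: simple_s; rewrite in_cons cs orbT.
by exists (b * t); rewrite big_cons -mulgA Et mulgA Eb mulgA.
Qed.

Lemma garside_twistr m : exists t, Delta * m = t * Delta.
Proof.
have [s + <-] := garside_simple_generate hM m.
elim: s => [_|a s IHs simple_s]; first by exists 1; rewrite big_nil mul1g mulg1.
have [b Eb] := simple_twistr (simple_s a (mem_head _ _)).
have [|t Et] := IHs => [c cs|]; first by apply: simple_s; rewrite in_cons cs orbT.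
by exists (b * t); rewrite big_cons mulgA Eb -!mulgA Et.
Qed.

(** Each simple factor costs one [Delta]: the complement of the first factor is moved to the right
    past the power of [Delta] that the remaining factors divide. *)
Lemma ldiv_garside_power m : exists k, ldiv m (Delta ^+ k).
Proof.
have twist k r : exists t, r * Delta ^+ k = Delta ^+ k * t.
  elim: k r => [|k IHk] r; first by exists r; rewrite mul1g mulg1.
  have [t Et] := garside_twistl r; have [u Eu] := IHk t.
  by exists u; rewrite expgS mulgA Et -mulgA Eu mulgA.
have [s + <-] := garside_simple_generate hM m.
elim: s => [_|a s IHs simple_s]; first by exists 0%N; exists 1; rewrite big_nil mul1g.
have [|k [r Er]] := IHs => [c cs|]; first by apply: simple_s; rewrite in_cons cs orbT.
have [r' Er'] := simple_s a (mem_head _ _).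
have [t Et] := twist k r'.
by exists k.+1; exists (r * t); rewrite expgS {1}Er' -mulgA Et Er big_cons !mulgA.
Qed.

End GarsideMonoidTheory.

(** * The order, meets and intervals in the group of fractions *)

Section GarsideGroupTheory.
Context {M : monoidType} {Delta : M} {G : groupType} {iota : M -> G}.
Context (hM : garside_monoid Delta) (hG : group_of_fractions iota).
Implicit Types (x y z d g s t u : G) (p q k : int).

Local Notation D := (DeltaX iota Delta).
Local Notation "x '<<=' y" := (prec iota x y) (at level 70, no associativity).
Local Notation meet := (meet iota).

Let iota1 : iota 1 = 1. Proof. exact: (fractions_morphism hG).1. Qed.
Let iotaM : {morph iota : m n / m * n}.
Proof. exact: (fractions_morphism hG).2. Qed.

Lemma DeltaX0 : D 0%R = 1. Proof. by []. Qed.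

Lemma DeltaX1 : D 1%R = iota Delta. Proof. by []. Qed.

Lemma DeltaXD p q : D (p + q)%R = D p * D q. Proof. exact: expgzD. Qed.

Lemma DeltaXN p : D (- p)%R = (D p)^-1. Proof. exact: expgzN. Qed.

Lemma DeltaXC p q : D p * D q = D q * D p.
Proof. by rewrite -!DeltaXD addrC. Qed.

Lemma DeltaX_nat (n : nat) : D n%:Z = iota (Delta ^+ n).
Proof.
elim: n => [|n IHn]; first by rewrite iota1.
by rewrite intS DeltaXD IHn expgS iotaM.
Qed.

Lemma prec_refl x : x <<= x.
Proof. by exists 1; rewrite mulVg iota1. Qed.

Lemma prec_trans x y z : x <<= y -> y <<= z -> x <<= z.
Proof. by case=> m Em [n En]; exists (m * n); rewrite iotaM -Em -En mulgA mulgK. Qed.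

Lemma prec_anti x y : x <<= y -> y <<= x -> x = y.
Proof.
case=> m Em [n En].
have /(garside_conical hM) m1 : m * n = 1.
  by apply: (fractions_injective hG); rewrite iotaM -Em -En iota1 mulgA mulgK mulVg.
by apply: (mulgI x^-1); rewrite Em m1 iota1 mulVg.
Qed.

Lemma prec_mul2l g x y : (g * x <<= g * y) <-> (x <<= y).
Proof. by rewrite /prec invgM -mulgA mulKg. Qed.

Lemma precMr x m : x <<= x * iota m.
Proof. by exists m; rewrite mulKg. Qed.

Lemma precP x y : x <<= y -> exists m, y = x * iota m.
Proof. by case=> m Em; exists m; rewrite -Em mulVKg. Qed.

(** The order is invariant under left multiplication only; powers of [Delta] are allowed on the
    right because conjugation by them, in either direction, maps the monoid into itself. *)
Lemma prec_mul2r k x y : x <<= y -> x * D k <<= y * D k.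
Proof.
case/precP=> m ->.
suff [n En] : exists n, iota m * D k = D k * iota n.
  by rewrite -mulgA En mulgA; exact: precMr.
have twistr n : exists n', iota n * (iota Delta)^-1 = (iota Delta)^-1 * iota n'.
  have [n' En'] := garside_twistr hM n; exists n'.
  by apply: (mulgI (iota Delta)); rewrite mulVKg mulgA -iotaM En' iotaM mulgK.
elim: k m => [|k IHk|k IHk] m; first by exists m; rewrite DeltaX0 mulg1 mul1g.
  have [n En] := IHk m; have [n' En'] := garside_twistl hM n.
  exists n'; rewrite intS addrC DeltaXD mulgA En -!mulgA; congr (_ * _).
  by rewrite DeltaX1 -!iotaM En'.
have [n En] := IHk m; have [n' En'] := twistr n.
exists n'; rewrite intS opprD addrC DeltaXD mulgA En -!mulgA; congr (_ * _).
by rewrite DeltaXN DeltaX1.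
Qed.

Lemma DeltaX_le p q : (p <= q)%R -> D p <<= D q.
Proof.
move=> lepq; have [n En] : exists n : nat, q = (p + n%:Z)%R by exists `|q - p|%N; lia.
by rewrite En DeltaXD DeltaX_nat; exact: precMr.
Qed.

(** Write [x] as a fraction with denominator [a]. If [Delta ^+ k = a * c], the inverse of [a] is [c]
    times the inverse of [Delta ^+ k], hence lies above the latter. *)
Lemma prec_DeltaX_lower x : exists p, D p <<= x.
Proof.
have [a [b ->]] := fractions_surjective hG x.
have [k [c Ec]] := ldiv_garside_power hM a.
exists (- k%:Z)%R; apply: (@prec_trans _ (iota a)^-1); last exact: precMr.
have -> : (iota a)^-1 = iota c * D (- k%:Z)%R.
  by rewrite DeltaXN DeltaX_nat Ec iotaM invgM mulVKg.
rewrite -{1}[D _]mul1g; apply: prec_mul2r; rewrite -[iota c]mul1g; exact: precMr.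
Qed.

Lemma prec_DeltaX_upper x : exists p, x <<= D p.
Proof.
have [p /precP [m ->]] := prec_DeltaX_lower x.
have [k [r Er]] := ldiv_garside_power hM m.
exists (p + k%:Z)%R; rewrite DeltaXD prec_mul2l DeltaX_nat Er iotaM; exact: precMr.
Qed.

Lemma prec_mulD k x y : (x * D k <<= y * D k) <-> (x <<= y).
Proof.
split; last exact: prec_mul2r.
by move=> /(prec_mul2r (- k)%R); rewrite DeltaXN !mulgK.
Qed.

Lemma prec_iota m n : (iota m <<= iota n) <-> ldiv m n.
Proof.
split=> [/precP [r]|[r ->]]; last by rewrite iotaM; exact: precMr.
by rewrite -iotaM => /(fractions_injective hG) ->; exists r.
Qed.

Lemma meet_exists x y : exists d, is_meet iota x y d.
Proof.
(* Left gcds in the monoid, translated by [D a], give a greatest lower bound among the elements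
   above [D a]. *)
have gcd a : D a <<= x -> D a <<= y -> exists d,
    [/\ d <<= x, d <<= y, D a <<= d &
     forall z, D a <<= z -> z <<= x -> z <<= y -> z <<= d].
  move=> /precP [m ->] /precP [n ->].
  have [e [em en maxe]] := garside_lgcd hM m n.
  exists (D a * iota e); split; first by apply/prec_mul2l/prec_iota.
  - by apply/prec_mul2l/prec_iota.
  - exact: precMr.
  by move=> _ /precP [z ->]; rewrite !prec_mul2l !prec_iota; exact: maxe.
have [a1 a1x] := prec_DeltaX_lower x; have [a2 a2y] := prec_DeltaX_lower y.
pose a := Num.min a1 a2.
have ax : D a <<= x by apply: prec_trans a1x; apply: DeltaX_le; lia.
have ay : D a <<= y by apply: prec_trans a2y; apply: DeltaX_le; lia.
have [d [dx dy _ maxd]] := gcd a ax ay.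
exists d; split=> // z zx zy.
(* A lower bound [z] need not lie above [D a]. The bound [e] relative to the smaller [D b] dominates
   both [z] and [D a], so [d] dominates [e]. *)
have [b1 b1z] := prec_DeltaX_lower z; pose b := Num.min a b1.
have ba : D b <<= D a by apply: DeltaX_le; lia.
have [e [ex ey _ maxe]] := gcd b (prec_trans ba ax) (prec_trans ba ay).
apply: (@prec_trans _ e).
  by apply: maxe => //; apply: prec_trans b1z; apply: DeltaX_le; lia.
by apply: maxd => //; apply: maxe.
Qed.

Lemma meetP x y : is_meet iota x y (meet x y).
Proof. exact: xgetPex (meet_exists x y). Qed.

Lemma prec_meetl x y : meet x y <<= x. Proof. by case: (meetP x y). Qed.

Lemma prec_meetr x y : meet x y <<= y. Proof. by case: (meetP x y). Qed.

Lemma prec_meet x y z : z <<= x -> z <<= y -> z <<= meet x y.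
Proof. by case: (meetP x y) => _ _; apply. Qed.

Lemma meet_eq x y d : is_meet iota x y d -> meet x y = d.
Proof.
case=> dx dy maxd; apply: prec_anti; last exact: prec_meet.
by apply: maxd; [exact: prec_meetl|exact: prec_meetr].
Qed.

Lemma meet_precl x y : x <<= y -> meet x y = x.
Proof. by move=> xy; apply: meet_eq; split=> //; exact: prec_refl. Qed.

Lemma meet_precr x y : y <<= x -> meet x y = y.
Proof. by move=> yx; apply: meet_eq; split=> //; exact: prec_refl. Qed.

Lemma meet_interchange x y z t : meet (meet x y) (meet z t) = meet (meet x z) (meet y t).
Proof.
have le a b c d : meet (meet a b) (meet c d) <<= meet (meet a c) (meet b d).
  have l := prec_meetl (meet a b) (meet c d).
  have r := prec_meetr (meet a b) (meet c d).
  apply: prec_meet; apply: prec_meet.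
  - exact: prec_trans l (prec_meetl _ _).
  - exact: prec_trans r (prec_meetl _ _).
  - exact: prec_trans l (prec_meetr _ _).
  - exact: prec_trans r (prec_meetr _ _).
by apply: prec_anti.
Qed.

Lemma mul_meetl g x y : g * meet x y = meet (g * x) (g * y).
Proof.
symmetry; apply: meet_eq; split; first by apply/prec_mul2l; exact: prec_meetl.
  by apply/prec_mul2l; exact: prec_meetr.
move=> z; rewrite -(mulVKg g z) !prec_mul2l; exact: prec_meet.
Qed.

Lemma mul_meetr k x y : meet x y * D k = meet (x * D k) (y * D k).
Proof.
symmetry; apply: meet_eq; split; first by apply/prec_mul2r/prec_meetl.
  by apply/prec_mul2r/prec_meetr.
move=> z; have -> : z = z * D (- k)%R * D k by rewrite DeltaXN mulgVK.
rewrite !prec_mulD; exact: prec_meet.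
Qed.

Definition DeltaX_itv p q : set G := [set x | D p <<= x /\ x <<= D q].

Lemma meet_DeltaXS x k : meet x (D (k + 1)%R) <<= meet x (D k) * D 1%R.
Proof.
rewrite mul_meetr -DeltaXD; apply: prec_meet (prec_meetr _ _).
by apply: prec_trans (prec_meetl _ _) _; exact: precMr.
Qed.

(** An element of the interval from 1 to [D (n + 1)] is its meet with [D n] times a simple element,
    and the simple elements are finitely many. *)
Lemma DeltaX_itv_finite p q : finite_set (DeltaX_itv p q).
Proof.
have fin1 (n : nat) : finite_set (DeltaX_itv 0%R n%:Z).
  elim: n => [|n IHn].
    apply: sub_finite_set (finite_set1 (1 : G)) => x [x1 x2].
    by rewrite /=; apply: prec_anti.
  apply: (sub_finite_set _ (finite_image2 (fun x a => x * iota a)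
    IHn (garside_finite_simple hM))) => x [x1 x2].
  have /precP [a Ea] : meet x (D n%:Z) <<= x by exact: prec_meetl.
  exists (meet x (D n%:Z)).
    by split; [apply: prec_meet => //; exact: DeltaX_le|exact: prec_meetr].
  exists a => //=; apply/prec_iota/(prec_mul2l (meet x (D n%:Z))).
  rewrite -Ea -DeltaX1; apply: prec_trans (meet_DeltaXS _ _).
  by rewrite addrC -intS meet_precl //; exact: prec_refl.
(* Only [q - p <= n] matters, so the absolute value also covers [q < p]. *)
pose n := `|q - p|%N.
apply: (sub_finite_set _ (finite_image (fun x => D p * x) (fin1 n))) => x [x1 x2].
exists ((D p)^-1 * x); last by rewrite mulVKg.
split; apply/(prec_mul2l (D p)); rewrite mulVKg -?DeltaXD ?addr0 //.
by apply: prec_trans x2 _; apply: DeltaX_le; lia.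
Qed.

Lemma prec_DeltaX_itv x : exists p q, DeltaX_itv p q x.
Proof.
have [p px] := prec_DeltaX_lower x; have [q xq] := prec_DeltaX_upper x.
by exists p, q.
Qed.

End GarsideGroupTheory.

(** * Transport of conjugators along cycling, and stability of periodic sets *)

Section Transport.
Context {M : monoidType} {Delta : M} {G : groupType} {iota : M -> G}.
Context (hM : garside_monoid Delta) (hG : group_of_fractions iota).
Implicit Types (x y z d g s t u : G) (p q k : int).

Local Notation D := (DeltaX iota Delta).
Local Notation "x '<<=' y" := (prec iota x y) (at level 70, no associativity).
Local Notation meet := (meet iota).
Local Notation cycling := (cycling iota Delta).
Local Notation periodic := (cycling_periodic iota Delta).
Local Notation itv := (@DeltaX_itv M Delta G iota).

Fixpoint cycling_conjugator p (n : nat) x : G :=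
  if n is n'.+1 then meet x (D p) * cycling_conjugator p n' (cycling p x) else 1.

Lemma conj_cycling_conjugator p n x :
  x ^ cycling_conjugator p n x = iter n (cycling p) x.
Proof.
elim: n x => [|n IHn] x; first by rewrite conjg1.
by rewrite iterSr -IHn /= conjgM.
Qed.

(** The fourth side of the square formed by [s] and the conjugators of the [n]-fold cyclings of [x]
    and [x ^ s]. *)
Definition transport p (n : nat) x s : G :=
  (cycling_conjugator p n x)^-1 * s * cycling_conjugator p n (x ^ s).

Lemma iter_cycling_transport p n x s :
  iter n (cycling p) x ^ transport p n x s = iter n (cycling p) (x ^ s).
Proof.
by rewrite /transport -!conj_cycling_conjugator -!conjgM !mulgA mulgV mul1g.
Qed.

Lemma transport1 p x s :
  transport p 1 x s = (meet x (D p))^-1 * meet (x * s) (s * D p).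
Proof.
by rewrite /transport /= !mulg1 -mulgA (mul_meetl hM hG) conjgE mulVKg.
Qed.

Lemma transportS p n x s :
  transport p n.+1 x s = transport p n (cycling p x) (transport p 1 x s).
Proof.
have := iter_cycling_transport p 1 x s; rewrite /transport /= => ->.
by rewrite !mulg1 invgM !mulgA.
Qed.

(** By [transport1] and [transportS] it suffices that [s |-> x * s] and [s |-> s * D p] preserve
    meets; [meet_interchange] regroups the four terms. *)
Lemma transport_meet p n x s t :
  transport p n x (meet s t) = meet (transport p n x s) (transport p n x t).
Proof.
elim: n x s t => [|n IHn] x s t; first by rewrite /transport /= invg1 !mul1g !mulg1.
rewrite !(transportS p n) -IHn; congr transport; rewrite !transport1.
by rewrite -(mul_meetl hM hG) (mul_meetl hM hG x) (mul_meetr hM hG) (meet_interchange hM hG).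
Qed.

Lemma cycling_conjD p k x : cycling p (x ^ D k) = cycling p x ^ D k.
Proof.
rewrite /cycling -!conjgM; congr (x ^ _).
by rewrite (mul_meetr hM hG) (DeltaXC p) (mul_meetl hM hG) conjgE mulVKg.
Qed.

Lemma transport_DeltaX p n x k : transport p n x (D k) = D k.
Proof.
elim: n x => [|n IHn] x; first by rewrite /transport /= invg1 mul1g mulg1.
rewrite transportS transport1 (DeltaXC k) -(mul_meetr hM hG) mulKg.
exact: IHn.
Qed.

Lemma transport_prec p n x s t : s <<= t -> transport p n x s <<= transport p n x t.
Proof.
move=> st; rewrite -{1}(meet_precl hM hG st) transport_meet.
exact: (prec_meetr hM hG).
Qed.

Lemma transport_periodic p n x s :
  iter n (cycling p) x = x -> iter n (cycling p) (x ^ s) = x ^ s ->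
  exists2 k, (0 < k)%N & iter k (transport p n x) s = s.
Proof.
move=> fix_x fix_xs; have [a [b [a_s s_b]]] := prec_DeltaX_itv hM hG s.
(* Transport keeps the interval, being monotone and fixing its endpoints. On [A] the outer factors
   depend only on [x] and [x ^ s], so they cancel and transport is injective. *)
pose A : set G := [set t | x ^ t = x ^ s] `&` itv a b.
apply: (@finite_injective_periodic _ A) => //.
- exact/finite_setIr/(DeltaX_itv_finite hM hG).
- move=> t [xt [a_t t_b]]; split; last first.
    by split; rewrite -(transport_DeltaX p n x); exact: transport_prec.
  by rewrite /= -{1}fix_x iter_cycling_transport xt.
- move=> t t' [xt _] [xt' _]; rewrite /transport xt xt'.
  by move=> /mulIg /mulgI.
Qed.

(** Converts a period of the conjugator [s] under transport into a period of [x ^ s] under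
    cycling. *)
Lemma iter_transport p n x s (k : nat) : iter n (cycling p) x = x ->
  x ^ iter k (transport p n x) s = iter (k * n) (cycling p) (x ^ s).
Proof.
move=> fix_x; elim: k => // k IHk.
by rewrite mulSn iterD -IHk -iter_cycling_transport fix_x.
Qed.

Lemma iter_transport_meet p n x s t (k : nat) :
  iter k (transport p n x) (meet s t) =
  meet (iter k (transport p n x) s) (iter k (transport p n x) t).
Proof. by elim: k => //= k ->; rewrite transport_meet. Qed.

Lemma cycling_periodic_meet p x s t :
  periodic p x -> periodic p (x ^ s) -> periodic p (x ^ t) ->
  periodic p (x ^ meet s t).
Proof.
move=> [n1 n1_gt0 fix1] [n2 n2_gt0 fix2] [n3 n3_gt0 fix3].
(* A common period of the three elements. With [k] and [l] the transport periods of [s] and [t],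
   [k * l] transports fix both, hence their meet. *)
pose n := (n1 * n2 * n3)%N.
have fix_x : iter n (cycling p) x = x.
  by rewrite /n (mulnC n1) mulnAC; apply: iter_periodic.
have fix_xs : iter n (cycling p) (x ^ s) = x ^ s.
  by rewrite /n mulnAC; apply: iter_periodic.
have fix_xt : iter n (cycling p) (x ^ t) = x ^ t by apply: iter_periodic.
have [k k_gt0 fix_s] := transport_periodic fix_x fix_xs.
have [l l_gt0 fix_t] := transport_periodic fix_x fix_xt.
exists (k * l * n)%N; first by rewrite !muln_gt0 k_gt0 l_gt0 n1_gt0 n2_gt0.
rewrite -iter_transport // iter_transport_meet; congr (_ ^ meet _ _).
  by rewrite mulnC; exact: iter_periodic.
exact: iter_periodic.
Qed.

Lemma cycling_periodic_conjD p k x : periodic p x -> periodic p (x ^ D k).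
Proof.
case=> n n_gt0 fix_x; exists n => //; rewrite -{2}fix_x.
by elim: n {n_gt0 fix_x} => //= n ->; rewrite cycling_conjD.
Qed.

Lemma conjg_id x : x ^ x = x.
Proof. by rewrite conjgE mulKg. Qed.

Lemma cycling_periodic_cycling p q x : periodic p x -> periodic p (cycling q x).
Proof.
move=> per_x; apply: cycling_periodic_meet => //; first by rewrite conjg_id.
exact: cycling_periodic_conjD.
Qed.

Lemma prec_conjr x y s : (y <<= x ^ s) <-> (s * y <<= x * s).
Proof. by rewrite -(prec_mul2l s y) conjgE mulVKg. Qed.

Lemma prec_conjl x y s : (x ^ s <<= y) <-> (x * s <<= s * y).
Proof. by rewrite -(prec_mul2l s _ y) conjgE mulVKg. Qed.

(** The bounds on [x ^ s] compare [x * s] with [s * D p] and [s * D q]; all three expressions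
    preserve meets in [s]. *)
Lemma DeltaX_itv_meet p q x s t :
  itv p q (x ^ s) -> itv p q (x ^ t) -> itv p q (x ^ meet s t).
Proof.
move=> [/prec_conjr ps /prec_conjl sq] [/prec_conjr pt /prec_conjl tq].
split; [apply/prec_conjr|apply/prec_conjl];
  rewrite (mul_meetl hM hG) (mul_meetr hM hG); apply: (prec_meet hM hG).
- exact: (prec_trans hG (prec_meetl hM hG _ _) ps).
- exact: (prec_trans hG (prec_meetr hM hG _ _) pt).
- exact: (prec_trans hG (prec_meetl hM hG _ _) sq).
- exact: (prec_trans hG (prec_meetr hM hG _ _) tq).
Qed.

Lemma DeltaX_itv_conjD p q k x : itv p q x -> itv p q (x ^ D k).
Proof.
move=> [px xq]; split; [apply/prec_conjr|apply/prec_conjl];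
  by rewrite DeltaXC; apply/(prec_mul2r hM hG).
Qed.

Lemma DeltaX_itv_cycling p q k x : itv p q x -> itv p q (cycling k x).
Proof.
move=> itv_x; apply: DeltaX_itv_meet; first by rewrite conjg_id.
exact: DeltaX_itv_conjD.
Qed.

Lemma DeltaX_itv_iter_cycling p q k n x :
  itv p q x -> itv p q (iter n (cycling k) x).
Proof. by move=> itv_x; elim: n => //= n; exact: DeltaX_itv_cycling. Qed.

(** Above [D p], cycling of order [p] is conjugation by [D p], which is injective, and it acts on a
    finite interval containing [x]. *)
Lemma cycling_periodic_low p x : D p <<= x -> periodic p x.
Proof.
move=> px; have [q xq] := prec_DeltaX_upper hM hG x.
apply: (@finite_injective_periodic _ (itv p q)) => //.
- exact: (DeltaX_itv_finite hM hG _ _).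
- by move=> y; exact: DeltaX_itv_cycling.
- move=> y z [py _] [pz _].
  rewrite /cycling (meet_precr hM hG py) (meet_precr hM hG pz); exact: conjg_inj.
Qed.

(** Here cycling conjugates [x] by itself, so [x] is a fixed point. *)
Lemma cycling_periodic_high p x : x <<= D p -> periodic p x.
Proof.
by move=> xp; exists 1%N; rewrite //= /cycling (meet_precl hM hG xp) conjg_id.
Qed.

Lemma first_repetition_cycling q x : exists N, first_repetition (cycling q) x N.
Proof.
have [a [b itv_x]] := prec_DeltaX_itv hM hG x.
apply/first_repetition_exists/(finite_orbit_looping (DeltaX_itv_finite hM hG a b)).
by move=> n; exact: DeltaX_itv_iter_cycling.
Qed.

End Transport.

(** * Existence of normal forms, and the bounds by inf and sup *)

Section NormalForm.
Context {M : monoidType} {Delta : M} {G : groupType} {iota : M -> G}.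
Context (hM : garside_monoid Delta) (hG : group_of_fractions iota).
Implicit Types (x : G) (p q k : int).

Local Notation D := (DeltaX iota Delta).
Local Notation "x '<<=' y" := (prec iota x y) (at level 70, no associativity).
Local Notation meet := (meet iota).

(** One equality forces the next by [meet_DeltaXS], so the meets are constant from [k] on, while
    they equal [x] for large exponents. This excludes trivial factors in the normal form. *)
Lemma DeltaX_stationary x k : meet x (D k) = meet x (D (k + 1)%R) -> x <<= D k.
Proof.
have stepP j : meet x (D j) = meet x (D (j + 1)%R) ->
    meet x (D (j + 1)%R) = meet x (D (j + 1 + 1)%R).
  move=> Ej; apply: (prec_anti hM hG).
    apply: (prec_meet hM hG); first exact: (prec_meetl hM hG _ _).
    apply: (prec_trans hG (prec_meetr hM hG _ _) _).
    by apply: (DeltaX_le hG); lia.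
  apply: (prec_meet hM hG); first exact: (prec_meetl hM hG _ _).
  apply: (prec_trans hG (meet_DeltaXS hM hG _ _) _); rewrite -Ej.
  rewrite DeltaXD; apply/(prec_mul2r hM hG); exact: (prec_meetr hM hG _ _).
move=> Ek; have [q xq] := prec_DeltaX_upper hM hG x.
have stat (n : nat) : meet x (D (k + n%:Z)%R) = meet x (D k) /\
    meet x (D (k + n%:Z)%R) = meet x (D (k + n%:Z + 1)%R).
  elim: n => [|n [IH1 IH2]]; first by rewrite addr0.
  have -> : (k + n.+1%:Z = k + n%:Z + 1)%R by lia.
  by rewrite -IH2; split=> //; rewrite IH2; exact: stepP.
have <- : meet x (D (k + `|q - k|%N%:Z)%R) = x.
  apply: (meet_precl hM hG); apply: (prec_trans hG xq _); apply: (DeltaX_le hG); lia.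
by rewrite (stat _).1; exact: (prec_meetr hM hG _ _).
Qed.

Lemma DeltaX_le_inv : Delta <> 1 -> forall p q, D p <<= D q -> (p <= q)%R.
Proof.
move=> Delta1 p q pq; rewrite leNgt; apply/negP => qp; apply: Delta1.
have E : D q = D p.
  by apply: (prec_anti hM hG) => //; apply: (DeltaX_le hG); exact: ltW.
have [n En] : exists n : nat, p = (q + n.+1%:Z)%R by exists `|p - q|.-1%N; lia.
apply: (garside_conical hM (b := Delta ^+ n)); rewrite -expgS.
apply: (fractions_injective hG); rewrite -(DeltaX_nat hG).
rewrite (fractions_morphism hG).1; apply: (mulgI (D q)).
by rewrite -DeltaXD -En E mulg1.
Qed.

Lemma normal_form_exists x : exists ps, is_normal_form iota Delta x ps.
Proof.
have [p0 p0x] := prec_DeltaX_lower hM hG x.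
have [q0 xq0] := prec_DeltaX_upper hM hG x.
(* If [Delta = 1], the group is trivial and no largest [p] with [D p <<= x] exists, so this case is
   settled separately. *)
have [Delta1|Delta1] := pselect (Delta = 1).
  have D1 k : D k = 1.
    by case: k => n; rewrite /DeltaX /= Delta1 (fractions_morphism hG).1
      expg1n ?invg1.
  have -> : x = 1 by apply: (prec_anti hM hG); [rewrite -(D1 q0)|rewrite -(D1 p0)].
  exists (0%R, [::]); split=> // [|i _].
    by rewrite big_nil D1 mul1g (fractions_morphism hG).1.
  rewrite !D1 /= big_nil mul1g (fractions_morphism hG).1.
  by apply: (meet_precl hM hG); exact: (prec_refl hG _).
have le_inv := DeltaX_le_inv Delta1.
have exp : exists n, `[< D (p0 + n%:Z)%R <<= x >].
  by exists 0%N; apply/asboolP; rewrite addr0.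
have bound n : `[< D (p0 + n%:Z)%R <<= x >] -> (n <= `|q0 - p0|)%N.
  by move=> /asboolP nx; have := le_inv _ _ (prec_trans hG nx xq0); lia.
case: (ex_maxnP exp bound) => n /asboolP; set p := (p0 + n%:Z)%R => px maxn.
have NDelta_x k : D k <<= x -> (k <= p)%R.
  move=> kx; rewrite leNgt; apply/negP => pk.
  have /maxn : `[< D (p0 + n.+1%:Z)%R <<= x >]; last by rewrite ltnn.
  by apply/asboolP; apply: (prec_trans hG _ kx); apply: (DeltaX_le hG); lia.
have exl : exists l, `[< x <<= D (p + l%:Z)%R >].
  exists `|q0 - p|%N; apply/asboolP; apply: (prec_trans hG xq0 _).
  by apply: (DeltaX_le hG); lia.
case: (ex_minnP exl) => l /asboolP xl minl.
(* With [p] maximal below [x] and [l] minimal above it, the normal form factors are the quotients of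
   consecutive [w i]. *)
pose w (i : nat) := meet x (D (p + i%:Z)%R).
have wS i : meet x (D (p + i%:Z + 1)%R) = w i.+1 by rewrite /w; congr (meet x (D _)); lia.
have w_le i : w i <<= w i.+1.
  apply: (prec_meet hM hG); first exact: (prec_meetl hM hG _ _).
  apply: (prec_trans hG (prec_meetr hM hG _ _) _); apply: (DeltaX_le hG); lia.
have [a Ea] := choice (fun i => precP (w_le i)).
have prodE i : D p * iota (\prod_(b <- mkseq a i) b) = w i.
  elim: i => [|i IHi].
    rewrite big_nil (fractions_morphism hG).1 mulg1 /w addr0.
    by symmetry; exact: (meet_precr hM hG _).
  by rewrite mkseqS big_rcons /= (fractions_morphism hG).2 mulgA IHi Ea.
exists (p, mkseq a l); rewrite /is_normal_form size_mkseq; split.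
- by rewrite prodE /w (meet_precl hM hG).
- move=> _ /mapP [i + ->]; rewrite mem_iota add0n => /andP [_ ltil].
  split.
  + apply/(prec_iota hG)/(prec_mul2l (w i)); rewrite -Ea -wS.
    exact: meet_DeltaXS.
  (* A trivial factor would contradict the minimality of [l]. *)
  + move=> ai1; have /DeltaX_stationary xi : meet x (D (p + i%:Z)%R) =
        meet x (D (p + i%:Z + 1)%R).
      by rewrite wS Ea ai1 (fractions_morphism hG).1 mulg1.
    by have := minl i; rewrite leqNgt ltil => /(_ (asboolT xi)).
  (* As [D p <<= w i], a factor [Delta] would put [D (p + 1)] below [w i.+1], hence below [x],
     against the maximality of [p]. *)
  + move=> aiD; suff /NDelta_x : D (p + 1)%R <<= x by rewrite gerDl ler10.
    apply: (prec_trans hG _ (prec_meetl hM hG x (D (p + i.+1%:Z)%R))).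
    rewrite -/(w _) Ea aiD DeltaXD; apply/(prec_mul2r hM hG 1%R).
    apply: (prec_meet hM hG) => //; apply: (DeltaX_le hG); lia.
- move=> i leil; rewrite (_ : take i (mkseq a l) = mkseq a i) ?prodE //.
  by rewrite /mkseq -map_take take_iota (minn_idPl leil).
Qed.

Lemma nf_inf_prec x : D (nf_inf iota Delta x) <<= x.
Proof.
rewrite /nf_inf; have := xgetPex (0%R, [::]) (normal_form_exists x).
rewrite -/(normal_form iota Delta x); case: normal_form => p s [-> _ _].
exact: precMr.
Qed.

Lemma nf_sup_prec x : x <<= D (nf_sup iota Delta x).
Proof.
rewrite /nf_sup; have := xgetPex (0%R, [::]) (normal_form_exists x).
rewrite -/(normal_form iota Delta x); case: normal_form => p s [Ex _].
(* At the last index the meet condition says that [x] equals its own meet with [D] of the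
   supremum. *)
move=> /(_ (size s) (leqnn _)); rewrite take_size -Ex => {1}<-.
exact: (prec_meetr hM hG _ _).
Qed.

End NormalForm.

(** * Termination and correctness of the loop *)

Section Algorithm.
Context {M : monoidType} {Delta : M} {G : groupType} {iota : M -> G}.
Context (hM : garside_monoid Delta) (hG : group_of_fractions iota).
Implicit Types (x y : G) (p q : int).

Lemma iter_cycling_conj_class q n x y :
  conj_class x y -> conj_class x (iter n (cycling iota Delta q) y).
Proof.
move=> xy; elim: n => //= n [u ->]; rewrite /cycling -conjgM; by eexists.
Qed.

(** All values stay in one finite interval, on which [nf_sup] is bounded by some [B]. Since [q]
    grows by 1 in each round, the induction is on a bound for [B - q]. *)
Lemma while_terminates q x : exists y, while_returns iota Delta q x y.
Proof.
have [a [b itv_x]] := prec_DeltaX_itv hM hG x.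
have [B leB] := finite_bounded (nf_sup iota Delta) (DeltaX_itv_finite hM hG a b).
have [n] : exists n : nat, (B - q <= n%:Z)%R by exists `|B - q|%N; lia.
elim: n q x itv_x => [|n IHn] q x itv_x leBq; have le_x := leB x itv_x;
    have [q_lt|q_ge] := boolP (q < nf_sup iota Delta x)%R;
    try by exists x; exact: WhileExit.
  lia.
have [N repN] := first_repetition_cycling hM hG q x.
have [|y ret_y] := IHn (q + 1)%R _ (DeltaX_itv_iter_cycling hM hG q N itv_x).
  lia.
by exists y; exact: WhileRound ret_y.
Qed.

(** The hypothesis on [p < q] is the loop invariant. A round adds order [q] through the repetition
    and keeps the earlier orders by [cycling_periodic_cycling]; at exit the orders from [q] on are
    at least the supremum. *)
Lemma while_returns_periodic q x y : while_returns iota Delta q x y ->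
  (forall p, (p < q)%R -> cycling_periodic iota Delta p x) ->
  conj_class x y /\ forall p, cycling_periodic iota Delta p y.
Proof.
elim=> {q x y} [q x q_ge|q x N y _ repN _ IH] per_x.
  split=> [|p]; first by exists 1; rewrite conjg1.
  have [/per_x //|le_qp] := ltP p q.
  apply: (cycling_periodic_high hM hG); apply: (prec_trans hG (nf_sup_prec hM hG x) _).
  apply: (DeltaX_le hG); lia.
have [|[u Eu] per_y] := IH.
  move=> p; rewrite ltzD1 le_eqVlt => /predU1P [->|/per_x per_p].
    exact: first_repetition_periodic repN.
  by elim: N {repN IH} => //= N; exact: cycling_periodic_cycling.
split=> //; have [v Ev] : conj_class x (iter N (cycling iota Delta q) x).
  by apply: iter_cycling_conj_class; exists 1; rewrite conjg1.
by exists (v * u); rewrite conjgM -Ev.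
Qed.

End Algorithm.

Theorem mainTheorem3 (M : monoidType) (Delta : M) (G : groupType)
    (iota : M -> G) (hM : garside_monoid Delta)
    (hG : group_of_fractions iota) (x : G) :
  (exists y : G, algorithm_returns iota Delta x y) /\
  (forall y : G, algorithm_returns iota Delta x y ->
     fully_refined_summit_set iota Delta x y).
Proof.
split=> [|y /(while_returns_periodic hM hG) ret_y]; first exact: while_terminates.
have [p|xy per_y] := ret_y; last by split=> // p _.
(* The starting value [inf x + 1] makes the invariant hold at entry: smaller orders are at most
   [inf x]. *)
rewrite ltzD1 => le_p; apply: (cycling_periodic_low hM hG).
apply: (prec_trans hG _ (nf_inf_prec hM hG x)); exact: (DeltaX_le hG).
Qed.
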